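(* Let $\mathcal{L}$ be a $\mathbb{C}[\partial]$-module, let $(\mathcal{L},\circ_\lambda)$ be a commutative associative conformal algebra and $(\mathcal{L},[\cdot_\lambda\cdot])$ a Lie conformal algebra. Then $(\mathcal{L},\circ_\lambda,[\cdot_\lambda\cdot])$ is both a Poisson conformal algebra and a transposed Poisson conformal algebra if and only if $$a\circ_\lambda[b_\mu c]=[b_{\mu-\lambda}a]\circ_\mu c=[(a\circ_\lambda b)_{\lambda+\mu}c]=0\qquad\text{for all }a,b,c\in\mathcal{L}.$$
   Context: All vector spaces, linear maps and tensor products are over $\mathbb{C}$. For a vector space $A$, $A[\lambda]$ denotes polynomials in $\lambda$ with coefficients in $A$. A conformal algebra $(A,\circ_\lambda)$ is a $\mathbb{C}[\partial]$-module $A$ with a $\mathbb{C}$-bilinear map $A\otimes A\to A[\lambda]$, $a\otimes b\mapsto a\circ_\lambda b$, such that $(\partial a)\circ_\lambda b=-\lambda\, a\circ_\lambda b$ and $a\circ_\lambda(\partial b)=(\partial+\lambda)(a\circ_\lambda b)$. Convention: products are extended linearly to polynomials in formal variables. If $a\circ_\lambda b=\sum_n\lambda^n w_n$ and $\nu$ is a linear combination of formal variables, then $a\circ_\nu b=\sum_n\nu^n w_n$ and $a\circ_{-\partial+\nu}b=\sum_n(-\partial+\nu)^n w_n$; the same convention applies to $[a_\lambda b]$. A commutative associative conformal algebra is a conformal algebra with $a\circ_\lambda(b\circ_\mu c)=(a\circ_\lambda b)\circ_{\lambda+\mu}c$ and $a\circ_\lambda b=b\circ_{-\partial-\lambda}a$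 for all $a,b,c$. A Lie conformal algebra $(A,[\cdot_\lambda\cdot])$ is a conformal algebra (with product written $[a_\lambda b]$) such that $[a_\lambda b]=-[b_{-\lambda-\partial}a]$ and $[a_\lambda[b_\mu c]]=[[a_\lambda b]_{\lambda+\mu}c]+[b_\mu[a_\lambda c]]$ for all $a,b,c$. A Poisson conformal algebra is a $\mathbb{C}[\partial]$-module $A$ with two $\mathbb{C}$-bilinear maps $\circ_\lambda,[\cdot_\lambda\cdot]:A\otimes A\to A[\lambda]$ such that $(A,\circ_\lambda)$ is a commutative associative conformal algebra, $(A,[\cdot_\lambda\cdot])$ is a Lie conformal algebra, and $[a_\lambda(b\circ_\mu c)]=[a_\lambda b]\circ_{\lambda+\mu}c+b\circ_\mu[a_\lambda c]$ for all $a,b,c\in A$. A transposed Poisson conformal algebra is defined in the same way, with the last identity replaced by $2(a\circ_\lambda[b_\mu c])=[(a\circ_\lambda b)_{\lambda+\mu}c]+[b_\mu(a\circ_\lambda c)]$ for all $a,b,c\in A$. *)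

(* Defs.v *)
From HB Require Import structures.
From mathcomp Require Import all_boot all_order all_algebra.
From mathcomp Require Import reals complex.
From mathcomp Require Import finmap monalg.

Set Implicit Arguments.
Unset Strict Implicit.
Unset Printing Implicit Defensive.

Import GRing.Theory.

Local Open Scope fset_scope.
Local Open Scope ring_scope.

(* The polynomials with monomials in K and coefficients in an S-module A.     *)
(* The alias keeps their structure of module over the ring {malg S[K]} apart  *)
(* from the instances that monalg puts on {malg A[K]} when A is a ring.       *)
Definition polymod (S : nzRingType) (A : lmodType S) (K : monomType) : Type :=
  {malg A[K]}.

HB.instance Definition _ (S : nzRingType) (A : lmodType S) (K : monomType) :=
  GRing.Zmodule.on (polymod A K).

HB.lock Definition pmscale (S : nzRingType) (A : lmodType S) (K : monomType)
    (p : {malg S[K]}) (f : polymod A K) : polymod A K :=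
  \sum_(k <- msupp p) \sum_(l <- msupp f) << p@_k *: f@_l *g mmul k l >>.

Section PolyModScale.
Context (S : nzRingType) (A : lmodType S) (K : monomType).
Implicit Types (p q : {malg S[K]}) (f g : polymod A K) (k l : K).

Lemma pmscalew (d1 d2 : {fset K}) p f : msupp p `<=` d1 -> msupp f `<=` d2 ->
  pmscale p f =
    \sum_(k <- d1) \sum_(l <- d2) << p@_k *: f@_l *g mmul k l >>.
Proof.
move=> le_d1 le_d2; rewrite pmscale.unlock (big_fset_incl _ le_d1) /=.
  apply/eq_bigr=> k _; apply/big_fset_incl => // l _ /mcoeff_outdom ->.
  by rewrite scaler0 monalgU0.
move=> k _ /mcoeff_outdom pk0.
by rewrite big1 // => l _; rewrite pk0 scale0r monalgU0.
Qed.

Lemma pmscaleDl f p q : pmscale (p + q) f = pmscale p f + pmscale q f.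
Proof.
rewrite [in RHS](pmscalew (fsubsetUl _ (msupp q)) (fsubset_refl _)).
rewrite [in RHS](pmscalew (fsubsetUr (msupp p) _) (fsubset_refl _)).
rewrite (pmscalew (msuppD_le _ _) (fsubset_refl _)) -big_split /=.
apply/eq_bigr=> k _; rewrite -big_split /=; apply/eq_bigr=> l _.
by rewrite mcoeffD scalerDl monalgUD.
Qed.

Lemma pmscaleDr p f g : pmscale p (f + g) = pmscale p f + pmscale p g.
Proof.
rewrite [in RHS](pmscalew (fsubset_refl _) (fsubsetUl _ (msupp g))).
rewrite [in RHS](pmscalew (fsubset_refl _) (fsubsetUr (msupp f) _)).
rewrite (pmscalew (fsubset_refl _) (msuppD_le _ _)) -big_split /=.
apply/eq_bigr=> k _; rewrite -big_split /=; apply/eq_bigr=> l _.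
by rewrite mcoeffD scalerDr monalgUD.
Qed.

Lemma pmscale0l f : pmscale 0 f = 0.
Proof. by rewrite pmscale.unlock msupp0 big_seq_fset0. Qed.

Lemma pmscale0r p : pmscale p (0 : polymod A K) = 0.
Proof.
by rewrite pmscale.unlock big1 // => k _; rewrite msupp0 big_seq_fset0.
Qed.

Lemma pmscaleUU (c : S) (a : A) k l :
  pmscale << c *g k >> << a *g l >> = << c *: a *g mmul k l >>.
Proof.
by rewrite (pmscalew msuppU_le msuppU_le) !big_seq_fset1 !mcoeffUU.
Qed.

Lemma pmscale_suml (I : Type) (r : seq I) (F : I -> {malg S[K]}) f :
  pmscale (\sum_(i <- r) F i) f = \sum_(i <- r) pmscale (F i) f.
Proof. exact: (big_morph _ (pmscaleDl f) (pmscale0l f)). Qed.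

Lemma pmscale_sumr (I : Type) (r : seq I) p (F : I -> polymod A K) :
  pmscale p (\sum_(i <- r) F i) = \sum_(i <- r) pmscale p (F i).
Proof. exact: (big_morph _ (pmscaleDr p) (pmscale0r p)). Qed.

Lemma pmscaleE p f :
  pmscale p f = \sum_(k <- msupp p) \sum_(l <- msupp f)
    pmscale << p@_k *g k >> << f@_l *g l >>.
Proof.
rewrite {1}pmscale.unlock.
by apply/eq_bigr=> k _; apply/eq_bigr=> l _; rewrite pmscaleUU.
Qed.

Lemma pmscaleA p q f : pmscale p (pmscale q f) = pmscale (p * q) f.
Proof.
rewrite [p in LHS]monalgE pmscale_suml malgME pmscale_suml; apply/eq_bigr=> k _.
rewrite pmscale_suml [pmscale q f]pmscaleE pmscale_sumr; apply/eq_bigr=> l _.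
rewrite pmscale_sumr [f in RHS]monalgE pmscale_sumr.
by apply/eq_bigr=> m _; rewrite !pmscaleUU scalerA mulmA.
Qed.

Lemma pmscale1 : left_id (1 : {malg S[K]}) (@pmscale S A K).
Proof.
move=> f; rewrite [f in LHS]monalgE pmscale_sumr [RHS]monalgE.
by apply/eq_bigr=> l _; rewrite pmscaleUU scale1r mul1m.
Qed.

HB.instance Definition _ :=
  GRing.Zmodule_isLmodule.Build {malg S[K]} (polymod A K)
    pmscaleA pmscale1 pmscaleDr pmscaleDl.

End PolyModScale.

(* A name of type conomType for {cmonom 'I_n}: with the bare type, unification *)
(* of its choiceType and conomType structures diverges on polymod terms.       *)
Definition expn_of (n : nat) : conomType := {cmonom 'I_n}.

Section ConformalAlgebras.
(* A C[d]-module is a module over {poly C}, the indeterminate 'X being d. *)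
Context (C : fieldType) (A : lmodType {poly C}).

(* C[d][x_0, ..., x_(n-1)] and A[x_0, ..., x_(n-1)] *)
Local Notation scal n := {malg {poly C}[expn_of n]}.
Local Notation pol n := (polymod A (expn_of n)).

Definition der {n} : scal n := 'X%:MP.

(* lambda is lam1 in A[lambda] and lam2 in A[lambda, mu]. *)
Definition lam1 : scal 1 := << (ucm ord0 : expn_of 1) >>.
Definition lam2 : scal 2 := << (ucm ord0 : expn_of 2) >>.
Definition mu : scal 2 := << (ucm ord_max : expn_of 2) >>.

Definition cst {n} (a : A) : pol n := << a *g (mone : expn_of n) >>.

(* \sum_k nu ^ k w_k, for w = \sum_k lambda ^ k w_k and nu a polynomial in *)
(* the formal variables and d: the substitution of nu for lambda.           *)
Definition subst n (nu : scal n) (w : pol 1) : pol n :=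
  \sum_(k <- msupp w) nu ^+ (k : {cmonom 'I_1}) ord0 *: cst w@_k.

(* The product a, b |-> a o_nu b, extended linearly to polynomials a, b in *)
(* the formal variables.                                                   *)
Definition cprod (op : A -> A -> pol 1) n (nu : scal n) (f g : pol n) : pol n :=
  \sum_(k <- msupp f) \sum_(l <- msupp g)
    (<< mmul k l >> : scal n) *: subst nu (op f@_k g@_l).

Record conformal_algebra (op : A -> A -> pol 1) : Prop := ConformalAlgebra {
  conf_linearl : forall (c : C) (a a' b : A),
    op (c%:P *: a + a') b = (c%:P%:MP : scal 1) *: op a b + op a' b;
  conf_linearr : forall (c : C) (a b b' : A),
    op a (c%:P *: b + b') = (c%:P%:MP : scal 1) *: op a b + op a b';
  conf_derl : forall a b : A, op ('X *: a) b = - lam1 *: op a b;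
  conf_derr : forall a b : A, op a ('X *: b) = (der + lam1) *: op a b
}.

Record comm_assoc_conformal (op : A -> A -> pol 1) : Prop :=
  CommAssocConformal {
  ca_conformal : conformal_algebra op;
  ca_assoc : forall a b c : A,
    cprod op lam2 (cst a) (cprod op mu (cst b) (cst c)) =
    cprod op (lam2 + mu) (cprod op lam2 (cst a) (cst b)) (cst c);
  ca_comm : forall a b : A,
    op a b = cprod op (- der - lam1) (cst b) (cst a)
}.

Record lie_conformal (br : A -> A -> pol 1) : Prop := LieConformal {
  lie_conf : conformal_algebra br;
  lie_skew : forall a b : A,
    br a b = - cprod br (- lam1 - der) (cst b) (cst a);
  lie_jacobi : forall a b c : A,
    cprod br lam2 (cst a) (cprod br mu (cst b) (cst c)) =
    cprod br (lam2 + mu) (cprod br lam2 (cst a) (cst b)) (cst c) +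
    cprod br mu (cst b) (cprod br lam2 (cst a) (cst c))
}.

Record poisson_conformal (op br : A -> A -> pol 1) : Prop := PoissonConformal {
  pois_comm_assoc : comm_assoc_conformal op;
  pois_lie : lie_conformal br;
  pois_leibniz : forall a b c : A,
    cprod br lam2 (cst a) (cprod op mu (cst b) (cst c)) =
    cprod op (lam2 + mu) (cprod br lam2 (cst a) (cst b)) (cst c) +
    cprod op mu (cst b) (cprod br lam2 (cst a) (cst c))
}.

Record transposed_poisson_conformal (op br : A -> A -> pol 1) : Prop :=
  TransposedPoissonConformal {
  tpois_comm_assoc : comm_assoc_conformal op;
  tpois_lie : lie_conformal br;
  tpois_leibniz : forall a b c : A,
    cprod op lam2 (cst a) (cprod br mu (cst b) (cst c)) *+ 2 =
    cprod br (lam2 + mu) (cprod op lam2 (cst a) (cst b)) (cst c) +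
    cprod br mu (cst b) (cprod op lam2 (cst a) (cst c))
}.

End ConformalAlgebras.

Arguments der {C n}.
Arguments lam1 {C}.
Arguments lam2 {C}.
Arguments mu {C}.
Arguments cst {C A n} a.

(* Main.v *)
Require Import Defs.
From mathcomp Require Import all_boot all_order all_algebra.
From mathcomp Require Import reals complex.
From mathcomp Require Import finmap monalg.

(** The proof transports to conformal algebras the classical argument for a
commutative algebra with a Lie bracket.  There, expanding the two brackets in
2 x [y, z] = [x y, z] + [y, x z] by the Leibniz rule leaves
y [x, z] = z [x, y]; so the trilinear map x [y, z] is invariant under
exchanging its first and third arguments, while it changes sign when the last
two are exchanged.  These two transpositions generate S_3 and a sign and a
trivial action of conjugate transpositions are incompatible: x [y, z] equals
its own opposite, hence is 0, and the Leibniz rule then gives [x y, z] = 0.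

In the conformal setting a triple product carries three spectral parameters:
besides the s and t attached to a and b in a o_s [b_t c], the argument c
carries r = - d - s - t, where d is the derivation applied to the whole
product.  Once every triple product is written with the outer d, permuting
the arguments means permuting the pairs (a, s), (b, t), (c, r), and the
classical computation goes through: [mixed_skew] is the sign rule,
[mixed_symm_of_leibniz] the invariance, and [mixed_symm_eq0] the
incompatibility of the two.  [opl_br_mixed] and [brl_op_mixed] express the
two other products of the theorem through a o_s [b_t c].  Conversely, when
a o_s [b_t c] and [(a o_s b)_t c] vanish, (skew-)commutativity shows that so
do all the terms of both Leibniz identities.

What remains is to justify the substitutions of parameters, some of which
involve d.  The maps in play (substitutions, multiplication by a constant on
either side, and their composites) are additive and turn multiplication by a
polynomial p into multiplication by another polynomial q; this is the relation
[slides].  Such a map is determined by its values on constants and by what it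
does to the variables ([semilinear_eq]); the substitutions in nested products
below, [nest_subst] and [sub_nest], rest on that uniqueness. *)

Set Implicit Arguments.
Unset Strict Implicit.
Unset Printing Implicit Defensive.

Import GRing.Theory.

Local Open Scope ring_scope.

(** * Monomials *)

Section Semilinear.
Context (C : fieldType) (A : lmodType {poly C}).

Local Notation scal n := {malg {poly C}[expn_of n]}.
Local Notation pol n := (polymod A (expn_of n)).

Definition var n (i : 'I_n) : scal n := << (ucm i : expn_of n) >>.

Definition monval n m (v : 'I_m -> scal n) (k : expn_of m) : scal n :=
  \prod_i v i ^+ (k : {cmonom 'I_m}) i.

Lemma monval1 n m (v : 'I_m -> scal n) : monval v mone = 1.
Proof. by rewrite /monval big1 // => i _; rewrite cm1 expr0. Qed.

Lemma monvalM n m (v : 'I_m -> scal n) k l :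
  monval v (mmul k l) = monval v k * monval v l.
Proof.
by rewrite /monval -big_split; apply: eq_bigr => i _; rewrite cmM exprD.
Qed.

Lemma monvalU n m (v : 'I_m -> scal n) i :
  monval v (ucm i : expn_of m) = v i.
Proof.
rewrite /monval (bigD1 i) //= cmUU expr1 big1 ?mulr1 // => j ji.
by rewrite cmU eq_sym (negPf ji) expr0.
Qed.

Lemma mulUU n (k l : expn_of n) : (<< k >> : scal n) * << l >> = << mmul k l >>.
Proof. by rewrite malgM_def fgmulUU mulr1. Qed.

Lemma exprU n (k : expn_of n) j :
  (<< k >> : scal n) ^+ j = << iter j (mmul k) mone >>.
Proof.
elim: j => [|j IH]; first by rewrite expr0; reflexivity.
by rewrite exprS IH mulUU; reflexivity.
Qed.

Lemma monval_var n (k : expn_of n) : monval (@var n) k = << k >>.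
Proof.
pose K i : expn_of n :=
  iter ((k : {cmonom 'I_n}) i) (mmul (ucm i : expn_of n)) mone.
rewrite /monval (eq_bigr (fun i => << K i >>)); last first.
  by move=> i _; exact: exprU.
rewrite -(big_morph (fun l : expn_of n => << l >> : scal n)
  (fun k l => esym (mulUU k l)) erefl).
congr (<< _ >>); apply/eqP/cmP => j.
rewrite (big_morph (fun l : {cmonom 'I_n} => l j) (cmM j) (cm1 j)).
have KE i : (K i : {cmonom 'I_n}) j = ((k : {cmonom 'I_n}) i * (i == j))%N.
  rewrite /K; elim: (fun_of_fsfun _ i) => [|e IH] /=; first by rewrite cm1.
  by rewrite cmM IH cmU mulSn.
rewrite (bigD1 j) //= KE eqxx muln1 big1 ?addn0 // => i ij.
by rewrite KE (negPf ij) muln0.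
Qed.

(** * Maps that turn multiplication by one polynomial into another *)

Definition slides m n (Phi : pol m -> pol n) (p : scal m) (q : scal n) :=
  forall f : pol m, Phi (p *: f) = q *: Phi f.

Section Slides.
Context m n (Phi : pol m -> pol n).
Hypothesis PhiD : {morph Phi : f g / f + g}.

Lemma morphD0 : Phi 0 = 0.
Proof. by apply: (addrI (Phi 0)); rewrite -PhiD !addr0. Qed.

Lemma morphDN f : Phi (- f) = - Phi f.
Proof. by apply: (addrI (Phi f)); rewrite -PhiD !subrr morphD0. Qed.

Lemma morphD_sum (I : Type) (r : seq I) (F : I -> pol m) :
  Phi (\sum_(i <- r) F i) = \sum_(i <- r) Phi (F i).
Proof. exact: (big_morph _ PhiD morphD0). Qed.

Lemma slides1 : slides Phi 1 1.
Proof. by move=> f; rewrite !scale1r. Qed.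

Lemma slidesD p p' q q' : slides Phi p q -> slides Phi p' q' ->
  slides Phi (p + p') (q + q').
Proof. by move=> h h' f; rewrite !scalerDl PhiD h h'. Qed.

Lemma slidesN p q : slides Phi p q -> slides Phi (- p) (- q).
Proof. by move=> h f; rewrite !scaleNr morphDN h. Qed.

Lemma slidesM p p' q q' : slides Phi p q -> slides Phi p' q' ->
  slides Phi (p * p') (q * q').
Proof. by move=> h h' f; rewrite -!scalerA h h'. Qed.

Lemma slidesX p q j : slides Phi p q -> slides Phi (p ^+ j) (q ^+ j).
Proof.
move=> h; elim: j => [|j IH]; first by rewrite !expr0; exact: slides1.
by rewrite !exprS; exact: slidesM.
Qed.

Lemma slides_monval l (u : 'I_l -> scal m) (v : 'I_l -> scal n) k :
  (forall i, slides Phi (u i) (v i)) -> slides Phi (monval u k) (monval v k).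
Proof.
move=> h; rewrite /monval.
elim/big_ind2: _ => [||i _]; [exact: slides1 | move=> *; exact: slidesM |].
exact/slidesX/h.
Qed.

End Slides.

(** Semilinearity along the substitution of v i for the i-th variable.  The
action on d is left out: it depends on the map, and a map is determined by its
values on constants without it. *)
Record semilinear m n (Phi : pol m -> pol n) (v : 'I_m -> scal n) : Prop :=
  Semilinear {
  semilinD : {morph Phi : f g / f + g};
  semilin_var : forall i, slides Phi (var i) (v i)
}.

Lemma eq_slides m n (Phi Psi : pol m -> pol n) p q :
  Phi =1 Psi -> slides Phi p q -> slides Psi p q.
Proof.
by move=> e h f; rewrite -[LHS]e h; congr (_ *: _); exact: e.
Qed.

Lemma eq_semilinear m n (Phi Psi : pol m -> pol n) v :
  Phi =1 Psi -> semilinear Phi v -> semilinear Psi v.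
Proof.
move=> e [D V]; split=> [f g|i]; last exact: eq_slides (V i).
by rewrite -[LHS]e D; congr (_ + _); exact: e.
Qed.

Lemma semilinear_comp l m n (Phi : pol m -> pol n) (Psi : pol l -> pol m)
    u v w :
  semilinear Phi v -> semilinear Psi u ->
  (forall i, slides Phi (u i) (w i)) -> semilinear (Phi \o Psi) w.
Proof.
case=> PhiD _ [PsiD Psiv] uw; split=> [f g|i f].
- exact: etrans (congr1 Phi (PsiD f g)) (PhiD _ _).
- exact: etrans (congr1 Phi (Psiv i f)) (uw i _).
Qed.

(** The monomials as elements of the module, which is where scalars act. *)
Definition monom n (a : A) (k : expn_of n) : pol n := << a *g k >>.

Lemma pol_sum n (f : pol n) : f = \sum_(k <- msupp f) monom f@_k k.
Proof. exact: monalgE. Qed.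

Lemma scale_monom n (c : {poly C}) (k l : expn_of n) (a : A) :
  (<< c *g k >> : scal n) *: monom a l = monom (c *: a) (mmul k l).
Proof. exact: pmscaleUU. Qed.

Lemma monomE n (a : A) (k : expn_of n) :
  monom a k = monval (@var n) k *: cst a.
Proof.
by rewrite monval_var -[cst a]/(monom a mone) scale_monom scale1r mulm1.
Qed.

(** A polynomial is a combination of constants whose coefficients are products
of variables, and these products can be moved through both maps. *)
Lemma semilinear_eq m n (Phi Psi : pol m -> pol n) v :
  semilinear Phi v -> semilinear Psi v ->
  (forall a, Phi (cst a) = Psi (cst a)) -> Phi =1 Psi.
Proof.
case=> PhiD Phiv [PsiD Psiv] eq_cst f.
rewrite (pol_sum f) (morphD_sum PhiD) (morphD_sum PsiD).
apply: eq_bigr => k _; rewrite monomE.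
by rewrite (slides_monval _ Phiv) (slides_monval _ Psiv) eq_cst.
Qed.

Section Extension.
Context m n (v : 'I_m -> scal n) (phi : A -> pol n).
Hypothesis phiD : {morph phi : a b / a + b}.

(** The semilinear map that extends phi from constants, by substitution of the
v i for the variables. *)
Definition extend (w : pol m) : pol n :=
  \sum_(k <- msupp w) monval v k *: phi w@_k.

Let phi0 : phi 0 = 0.
Proof. by apply: (addrI (phi 0)); rewrite -phiD !addr0. Qed.

Lemma extendw (d : {fset (expn_of m)}) w : (msupp w `<=` d)%fset ->
  extend w = \sum_(k <- d) monval v k *: phi w@_k.
Proof.
move=> le_d; rewrite /extend (big_fset_incl _ le_d) //=.
by move=> k _ /mcoeff_outdom ->; rewrite phi0 scaler0.
Qed.

Lemma extendD : {morph extend : f g / f + g}.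
Proof.
move=> f g.
rewrite (extendw (msuppD_le f g)).
rewrite (extendw (fsubsetUl (msupp f) (msupp g))).
rewrite (extendw (fsubsetUr (msupp f) (msupp g))) -big_split /=.
apply: eq_bigr => k _.
by rewrite mcoeffD phiD scalerDr.
Qed.

Lemma extend_monom a k : extend (monom a k) = monval v k *: phi a.
Proof. by rewrite (extendw msuppU_le) big_seq_fset1 mcoeffUU. Qed.

Lemma extend_cst a : extend (cst a) = phi a.
Proof.
by rewrite -[cst a]/(monom a mone) extend_monom monval1 scale1r.
Qed.

Lemma semilinear_extend : semilinear extend v.
Proof.
split=> [|i f]; first exact: extendD.
rewrite (pol_sum f) scaler_sumr !(morphD_sum extendD) scaler_sumr.
apply: eq_bigr => k _.
rewrite scale_monom scale1r [LHS]extend_monom monvalM monvalU.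
by rewrite extend_monom scalerA.
Qed.

Lemma extend_der (q : scal n) :
  (forall a, phi ('X *: a) = q *: phi a) -> slides extend der q.
Proof.
move=> phi_der f.
rewrite (pol_sum f) scaler_sumr !(morphD_sum extendD) scaler_sumr.
apply: eq_bigr => k _.
rewrite scale_monom mul1m [LHS]extend_monom phi_der scalerA mulrC.
by rewrite extend_monom scalerA.
Qed.

End Extension.

Lemma substE n (nu : scal n) : subst nu =1 extend (fun=> nu) (@cst C A n).
Proof.
move=> w; apply: eq_bigr => k _.
by rewrite /monval big_ord_recl big_ord0 mulr1.
Qed.

Lemma cstD n : {morph @cst C A n : a b / a + b}.
Proof. by move=> a b; exact: monalgUD. Qed.

Lemma cst_der n a : @cst C A n ('X *: a) = der *: cst a.
Proof. by apply: esym; rewrite [LHS]scale_monom mul1m. Qed.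

Lemma semilinear_subst n (nu : scal n) :
  semilinear (@subst C A n nu) (fun=> nu).
Proof.
apply: eq_semilinear (fsym (substE nu)) _.
exact: semilinear_extend (@cstD n).
Qed.

Lemma subst_der n (nu : scal n) : slides (@subst C A n nu) der der.
Proof.
apply: eq_slides (fsym (substE nu)) _.
by apply: extend_der; [exact: cstD | exact: cst_der].
Qed.

Lemma subst_lam1 n (nu : scal n) : slides (@subst C A n nu) lam1 nu.
Proof. exact: semilin_var (semilinear_subst nu) ord0. Qed.

Lemma subst_cst n (nu : scal n) (a : A) : subst nu (cst a) = cst a.
Proof. by rewrite substE extend_cst //; exact: cstD. Qed.

Lemma subst_phiD (phi : A -> pol 1) : {morph phi : a b / a + b} ->
  forall n (nu : scal n), {morph (fun a => subst nu (phi a)) : a b / a + b}.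
Proof.
move=> phiD n nu a b /=; rewrite phiD.
exact: semilinD (semilinear_subst nu) _ _.
Qed.

(** * Products of polynomials with a constant *)

Section Products.
Context (op : A -> A -> pol 1).
Hypothesis op_conf : conformal_algebra op.

Lemma conf_addl b : {morph op^~ b : a a' / a + a'}.
Proof.
move=> a a' /=; have := conf_linearl op_conf 1 a a' b.
by rewrite polyC1 mpolyC1E !scale1r.
Qed.

Lemma conf_addr a : {morph op a : b b' / b + b'}.
Proof.
move=> b b' /=; have := conf_linearr op_conf 1 a b b'.
by rewrite polyC1 mpolyC1E !scale1r.
Qed.

Context (n : nat) (nu : scal n).

Let subst_opDl b : {morph (fun a => subst nu (op a b)) : a a' / a + a'}.
Proof. exact: subst_phiD (conf_addl b) n nu. Qed.

Let subst_opDr a : {morph (fun b => subst nu (op a b)) : b b' / b + b'}.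
Proof. exact: subst_phiD (conf_addr a) n nu. Qed.

(** On the right, d inside the product becomes d + nu: this is where the inner
and the outer derivation differ. *)
Lemma subst_op_derr a b :
  subst nu (op a ('X *: b)) = (der + nu) *: subst nu (op a b).
Proof.
rewrite (conf_derr op_conf).
have h := slidesD (semilinD (semilinear_subst nu)) (@subst_der n nu)
  (@subst_lam1 n nu).
exact: (h (op a b)).
Qed.

Lemma subst_op0l b : subst nu (op 0 b) = 0.
Proof. by apply: (addrI (subst nu (op 0 b))); rewrite -subst_opDl !addr0. Qed.

Lemma subst_op0r a : subst nu (op a 0) = 0.
Proof. by apply: (addrI (subst nu (op a 0))); rewrite -subst_opDr !addr0. Qed.

Lemma cprod_cstl a :
  cprod op nu (cst a) =1 extend (@var n) (fun b => subst nu (op a b)).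
Proof.
move=> g; rewrite /cprod.
rewrite (big_fset_incl _ (msuppU_le : (msupp (cst a : pol n) `<=` _)%fset)) /=.
  rewrite big_seq_fset1; apply: eq_bigr => l _.
  by rewrite mcoeffUU mul1m monval_var.
move=> k _ /mcoeff_outdom ->.
by rewrite big1 // => l _; rewrite subst_op0l scaler0.
Qed.

Lemma cprod_cstr c :
  cprod op nu ^~ (cst c) =1 extend (@var n) (fun a => subst nu (op a c)).
Proof.
move=> f; apply: eq_bigr => k _.
rewrite (big_fset_incl _ (msuppU_le : (msupp (cst c : pol n) `<=` _)%fset)) /=.
  by rewrite big_seq_fset1 mcoeffUU mulm1 monval_var.
by move=> l _ /mcoeff_outdom ->; rewrite subst_op0r scaler0.
Qed.

Lemma cprod_cst a b : cprod op nu (cst a) (cst b) = subst nu (op a b).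
Proof. by rewrite cprod_cstl extend_cst //; exact: subst_opDr. Qed.

Lemma semilinear_cprodr a : semilinear (cprod op nu (cst a)) (@var n).
Proof.
apply: eq_semilinear (fsym (cprod_cstl a)) _.
exact: semilinear_extend (@subst_opDr a).
Qed.

Lemma semilinear_cprodl c : semilinear (cprod op nu ^~ (cst c)) (@var n).
Proof.
apply: eq_semilinear (fsym (cprod_cstr c)) _.
exact: semilinear_extend (@subst_opDl c).
Qed.

End Products.

(** The triple products: with phi := op1 a and w := op2 b c this is
a o_s (b o'_t c), and with phi := op1^~ c and w := op2 a b it is
(a o'_t b) o_s c.  Here t is substituted after the outer product has been
formed, so that a d occurring in t acts on the whole triple product. *)
Definition nest (phi : A -> pol 1) n (s t : scal n) (w : pol 1) : pol n :=
  extend (fun=> t) (fun a => subst s (phi a)) w.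

Section Nest.
Context (phi : A -> pol 1).
Hypothesis phiD : {morph phi : a b / a + b}.

Lemma semilinear_nest n (s t : scal n) : semilinear (nest phi s t) (fun=> t).
Proof. exact: semilinear_extend (subst_phiD phiD s). Qed.

Lemma nest_cst n (s t : scal n) a : nest phi s t (cst a) = subst s (phi a).
Proof. exact: extend_cst (subst_phiD phiD s) a. Qed.

Lemma nestN n (s t : scal n) w : nest phi s t (- w) = - nest phi s t w.
Proof. exact: morphDN (semilinD (semilinear_nest s t)) w. Qed.

(** A parameter nu of the inner product has to be moved through the outer one,
which turns an inner d into an expression in the outer d. *)
Lemma nest_subst n (s t t' : scal n) nu w : slides (nest phi s t) nu t' ->
  nest phi s t (subst nu w) = nest phi s t' w.
Proof.
move=> h; move: w; apply: semilinear_eq (semilinear_nest s t') _.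
  exact: semilinear_comp (semilinear_nest s t) (semilinear_subst nu) (fun=> h).
by move=> a /=; rewrite subst_cst !nest_cst.
Qed.

(** Identities between triple products in the formal variables may be
specialised to arbitrary parameters, even ones that involve d. *)
Lemma sub_nest m n (v : 'I_m -> scal n) (s t : scal m) (s' t' : scal n) w :
  slides (extend v cst) s s' -> slides (extend v cst) t t' ->
  extend v cst (nest phi s t w) = nest phi s' t' w.
Proof.
have sub := semilinear_extend v (@cstD n).
move=> hs ht; move: w; apply: semilinear_eq (semilinear_nest s' t') _.
  exact: semilinear_comp sub (semilinear_nest s t) (fun=> ht).
move=> a /=; rewrite !nest_cst; move: (phi a).
apply: semilinear_eq (semilinear_subst s') _.
  exact: semilinear_comp sub (semilinear_subst s) (fun=> hs).
by move=> b /=; rewrite !subst_cst extend_cst //; exact: cstD.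
Qed.

End Nest.

Lemma cprod_cprodr op1 op2 n (s t : scal n) a b c :
  conformal_algebra op1 -> conformal_algebra op2 ->
  slides (cprod op1 s (cst a)) t t ->
  cprod op1 s (cst a) (cprod op2 t (cst b) (cst c)) =
  nest (op1 a) s t (op2 b c).
Proof.
move=> conf1 conf2 st; rewrite (cprod_cst conf2); move: (op2 b c).
apply: semilinear_eq (semilinear_nest (conf_addr conf1 a) s t) _.
  exact: semilinear_comp (semilinear_cprodr conf1 s a) (semilinear_subst t)
    (fun=> st).
move=> w /=; rewrite subst_cst (cprod_cst conf1) nest_cst //.
exact: conf_addr.
Qed.

Lemma cprod_cprodl op1 op2 n (s t : scal n) a b c :
  conformal_algebra op1 -> conformal_algebra op2 ->
  slides (cprod op1 s ^~ (cst c)) t t ->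
  cprod op1 s (cprod op2 t (cst a) (cst b)) (cst c) =
  nest (op1^~ c) s t (op2 a b).
Proof.
move=> conf1 conf2 st; rewrite (cprod_cst conf2); move: (op2 a b).
apply: semilinear_eq (semilinear_nest (conf_addl conf1 c) s t) _.
  exact: semilinear_comp (semilinear_cprodl conf1 s c) (semilinear_subst t)
    (fun=> st).
move=> w /=; rewrite subst_cst (cprod_cst conf1) nest_cst //.
exact: conf_addl.
Qed.

Lemma nest_der op n (s t : scal n) a : conformal_algebra op ->
  slides (nest (op a) s t) der (der + s).
Proof.
move=> conf; apply: extend_der.
  by apply: subst_phiD; exact: conf_addr.
by move=> b; apply: subst_op_derr.
Qed.

Lemma eq_nest (phi psi : A -> pol 1) n (s s' t : scal n) w :
  (forall a, subst s (phi a) = subst s' (psi a)) ->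
  nest phi s t w = nest psi s' t w.
Proof. by move=> e; apply: eq_bigr => k _; rewrite e. Qed.

Lemma subst_subst n (nu' nu : scal n) (kap : scal 1) (w : pol 1) :
  slides (@subst C A n nu) kap nu' -> subst nu (subst kap w) = subst nu' w.
Proof.
move=> h; move: w; apply: semilinear_eq (semilinear_subst nu') _.
  exact: semilinear_comp (semilinear_subst nu) (semilinear_subst kap) (fun=> h).
by move=> a /=; rewrite !subst_cst.
Qed.

Lemma slides_subst_opp n (nu : scal n) :
  slides (@subst C A n nu) (- der - lam1) (- der - nu).
Proof.
have D := semilinD (semilinear_subst nu).
apply: (slidesD D); apply: (slidesN D); [exact: subst_der | exact: subst_lam1].
Qed.

Lemma nestNphi (phi : A -> pol 1) n (s t : scal n) w :
  nest (fun a => - phi a) s t w = - nest phi s t w.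
Proof.
rewrite /nest /extend -sumrN; apply: eq_bigr => k _.
by rewrite (morphDN (semilinD (semilinear_subst s))) scalerN.
Qed.

(** * Commutativity and skew-symmetry of nested products *)

Section LieSkew.
Context (br : A -> A -> pol 1).
Hypothesis br_lie : lie_conformal br.
Let br_conf := lie_conf br_lie.

Lemma lie_skewE a b : br a b = - subst (- lam1 - der) (br b a).
Proof. by rewrite (lie_skew br_lie a b) (cprod_cst br_conf). Qed.

(** Skew-symmetry of the inner bracket replaces t by - t - d for the inner d,
which is d + s for the outer one: the parameter of c is - d - s - t. *)
Lemma nest_skew op n (s t : scal n) a b c : conformal_algebra op ->
  nest (op a) s t (br b c) = - nest (op a) s (- der - s - t) (br c b).
Proof.
move=> conf; have phiD := conf_addr conf a.
have nestD := semilinD (semilinear_nest phiD s t).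
have slide : slides (nest (op a) s t) (- lam1 - der) (- der - s - t).
  have -> : - der - s - t = - t - (der + s) by rewrite addrC opprD.
  apply: (slidesD nestD); apply: (slidesN nestD).
    exact: (semilin_var (semilinear_nest phiD s t) ord0).
  exact: nest_der.
apply: etrans (congr1 (nest (op a) s t) (lie_skewE b c)) _.
apply: etrans (nestN phiD _ _ _) _.
have nestE := nest_subst phiD (br c b) slide.
exact: (congr1 (fun x : pol n => - x) nestE).
Qed.

Lemma nest_skewl n (s t : scal n) c w :
  nest (br^~ c) s t w = - nest (br c) (- der - s) t w.
Proof.
rewrite -nestNphi; apply: eq_nest => a; rewrite lie_skewE.
rewrite !(morphDN (semilinD (semilinear_subst _))) addrC.
by rewrite (subst_subst _ (slides_subst_opp s)).
Qed.

End LieSkew.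

Lemma nest_comml op n (s t : scal n) c w : comm_assoc_conformal op ->
  nest (op^~ c) s t w = nest (op c) (- der - s) t w.
Proof.
move=> op_ca; apply: eq_nest => a.
rewrite (ca_comm op_ca a c) (cprod_cst (ca_conformal op_ca)).
by rewrite (subst_subst _ (slides_subst_opp s)).
Qed.

Lemma polymod_double_eq0 n (f : pol n) :
  (2%:R : C) != 0 -> f *+ 2 = 0 -> f = 0.
Proof.
move=> two_neq0 f2.
have half2 : ((2%:R^-1 : C)%:P%:MP *+ 2 : scal n) = 1.
  have half1 : (2%:R^-1 : C) *+ 2 = 1 by rewrite -(mulr_natr 2%:R^-1) mulVf.
  by rewrite -[LHS]monalgUMn -polyCMn half1 polyC1 mpolyC1E.
by rewrite -[f]scale1r -half2 -scalerMnl scalerMnr f2 scaler0.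
Qed.

(** * The products of the shape a o [b, c] *)

Section TwoProducts.
Context (op br : A -> A -> pol 1).
Hypothesis op_ca : comm_assoc_conformal op.
Hypothesis br_lie : lie_conformal br.
Let op_conf := ca_conformal op_ca.
Let br_conf := lie_conf br_lie.

(** The product a o_s [b_t c].  The parameter of c, for which r stands below, is
- d - s - t. *)
Definition mixed n (s t : scal n) a b c : pol n := nest (op a) s t (br b c).

Lemma mixed_skew n (s t : scal n) a b c :
  mixed s t a b c = - mixed s (- der - s - t) a c b.
Proof. exact: nest_skew. Qed.

Lemma mixed_skew_eq n (s t r : scal n) a b c : - der - s - t = r ->
  mixed s t a b c = - mixed s r a c b.
Proof. by move=> <-; exact: mixed_skew. Qed.

(** The relation d + s + t + r = 0 is symmetric in s, t and r; this lemma and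
the next one generate all the permutations. *)
Lemma thirdC n (s t r : scal n) : - der - s - t = r -> - der - t - s = r.
Proof. by move=> <-; exact: addrAC. Qed.

Lemma thirdK n (s t r : scal n) : - der - s - t = r -> - der - s - r = t.
Proof. by move=> <-; exact: subKr. Qed.

Definition pair_var n (s t : scal n) (i : 'I_2) : scal n :=
  if i == ord0 then s else t.

Lemma slides_lam2 n (s t : scal n) :
  slides (extend (pair_var s t) (@cst C A n)) lam2 s.
Proof. exact: (semilin_var (semilinear_extend _ (@cstD n)) ord0). Qed.

Lemma slides_mu n (s t : scal n) :
  slides (extend (pair_var s t) (@cst C A n)) mu t.
Proof. exact: (semilin_var (semilinear_extend _ (@cstD n)) ord_max). Qed.

Lemma slides_lam2Dmu n (s t : scal n) :
  slides (extend (pair_var s t) (@cst C A n)) (lam2 + mu) (s + t).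
Proof.
apply: slidesD; [exact: extendD (@cstD n) | exact: slides_lam2 |].
exact: slides_mu.
Qed.

Lemma slides_third n (s t : scal n) :
  slides (extend (pair_var s t) (@cst C A n)) (- der - lam2 - mu)
    (- der - s - t).
Proof.
have D := @extendD 2 n (pair_var s t) _ (@cstD n).
apply: (slidesD D); last exact/(slidesN D)/slides_mu.
apply: (slidesD D); last exact/(slidesN D)/slides_lam2.
apply: (slidesN D); apply: extend_der; [exact: cstD | exact: cst_der].
Qed.

(** The hypothesis is the invariance of (a, s) o [(b, t), (c, r)] under the
exchange of its first and third arguments. *)
Lemma mixed_symm_eq0 n : (2%:R : C) != 0 ->
  (forall (s t : scal n) a b c,
     mixed t s b a c = mixed (- der - s - t) s c a b) ->
  forall (s t : scal n) a b c, mixed s t a b c = 0.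
Proof.
move=> two_neq0 symm s t a b c; apply: (polymod_double_eq0 two_neq0).
have [r rE] : exists r : scal n, - der - s - t = r by eexists.
have rE' := thirdC rE.
have symm_eq (u v w : scal n) a' b' c' : - der - u - v = w ->
    mixed v u b' a' c' = mixed w u c' a' b'.
  by move=> <-; exact: (symm u v a' b' c').
(* Alternating the two transpositions runs through all six orderings of the
   arguments and returns to a, b, c after an odd number of sign changes. *)
have chain : mixed s t a b c = - mixed s t a b c.
  apply: etrans (symm_eq _ _ _ _ _ _ rE') _.
  apply: etrans (mixed_skew_eq _ _ _ (thirdC (thirdK rE'))) _.
  apply: (congr1 (fun x : pol n => - x)).
  apply: etrans (esym (symm_eq _ _ _ _ _ _ rE)) _.
  apply: etrans (mixed_skew_eq _ _ _ rE') _.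
  apply: etrans (congr1 (fun x : pol n => - x)
    (symm_eq _ _ _ _ _ _ (thirdC (thirdK rE')))) _.
  apply: etrans (congr1 (fun x : pol n => - x)
    (mixed_skew_eq _ _ _ (thirdK rE))) _.
  exact: opprK.
by rewrite mulr2n {1}chain addNr.
Qed.

Lemma opp_der_subD n (s t : scal n) : - der - (s + t) = - der - s - t.
Proof. by rewrite opprD addrA. Qed.

Lemma op_br_mixed a b c :
  cprod op lam2 (cst a) (cprod br mu (cst b) (cst c)) = mixed lam2 mu a b c.
Proof.
apply: cprod_cprodr => //.
exact: (semilin_var (semilinear_cprodr op_conf lam2 a) ord_max).
Qed.

Lemma op_br_mixed_swap a b c :
  cprod op mu (cst b) (cprod br lam2 (cst a) (cst c)) = mixed mu lam2 b a c.
Proof.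
apply: cprod_cprodr => //.
exact: (semilin_var (semilinear_cprodr op_conf mu b) ord0).
Qed.

Lemma br_op_nest a b c :
  cprod br lam2 (cst a) (cprod op mu (cst b) (cst c)) =
  nest (br a) lam2 mu (op b c).
Proof.
apply: cprod_cprodr => //.
exact: (semilin_var (semilinear_cprodr br_conf lam2 a) ord_max).
Qed.

Lemma br_op_nest_swap a b c :
  cprod br mu (cst b) (cprod op lam2 (cst a) (cst c)) =
  nest (br b) mu lam2 (op a c).
Proof.
apply: cprod_cprodr => //.
exact: (semilin_var (semilinear_cprodr br_conf mu b) ord0).
Qed.

Lemma opl_br_nest a b c :
  cprod op (lam2 + mu) (cprod br lam2 (cst a) (cst b)) (cst c) =
  nest (op^~ c) (lam2 + mu) lam2 (br a b).
Proof.
apply: cprod_cprodl => //.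
exact: (semilin_var (semilinear_cprodl op_conf (lam2 + mu) c) ord0).
Qed.

Lemma brl_op_nest a b c :
  cprod br (lam2 + mu) (cprod op lam2 (cst a) (cst b)) (cst c) =
  nest (br^~ c) (lam2 + mu) lam2 (op a b).
Proof.
apply: cprod_cprodl => //.
exact: (semilin_var (semilinear_cprodl br_conf (lam2 + mu) c) ord0).
Qed.

Lemma opl_br_mixed a b c :
  cprod op mu (cprod br (mu - lam2) (cst b) (cst a)) (cst c) =
  mixed (- der - mu) (mu - lam2) c b a.
Proof.
have S := semilinear_cprodl op_conf mu c.
have D := semilinD S.
rewrite -[RHS]nest_comml //; apply: cprod_cprodl => //.
apply: (slidesD D); last apply: (slidesN D).
  exact: (semilin_var S ord_max).
exact: (semilin_var S ord0).
Qed.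

(** By commutativity, [a_s b] o_(s+t) c is the product c o_r [a_s b]. *)
Lemma nestl_mixed n (s t : scal n) a b c :
  nest (op^~ c) (s + t) s (br a b) = mixed (- der - s - t) s c a b.
Proof. by rewrite -opp_der_subD; exact: nest_comml. Qed.

Lemma sub_mixed m n (v : 'I_m -> scal n) (s t : scal m) (s' t' : scal n) a b c :
  slides (extend v cst) s s' -> slides (extend v cst) t t' ->
  extend v cst (mixed s t a b c) = mixed s' t' a b c.
Proof. by move=> hs ht; apply: sub_nest => //; exact: conf_addr. Qed.

(** * The Poisson and the transposed Poisson identities *)

(** Both terms on the right of the Leibniz rule are products of the shape
a o_s [b_t c], the first one by commutativity; this holds for arbitrary
parameters because it holds for the formal variables. *)
Lemma leibniz_nest n (s t : scal n) a b c :
  (forall a b c : A, cprod br lam2 (cst a) (cprod op mu (cst b) (cst c)) =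
    cprod op (lam2 + mu) (cprod br lam2 (cst a) (cst b)) (cst c) +
    cprod op mu (cst b) (cprod br lam2 (cst a) (cst c))) ->
  nest (br a) s t (op b c) =
    mixed (- der - s - t) s c a b + mixed t s b a c.
Proof.
move=> /(_ a b c).
rewrite br_op_nest opl_br_nest op_br_mixed_swap nestl_mixed.
move=> /(congr1 (extend (pair_var s t) cst)).
rewrite (extendD _ (@cstD n)) => leib.
have e1 := sub_nest (conf_addr br_conf a) (op b c)
  (slides_lam2 s t) (slides_mu s t).
have e2 := sub_mixed c a b (slides_third s t) (slides_lam2 s t).
have e3 := sub_mixed b a c (slides_mu s t) (slides_lam2 s t).
exact: etrans (esym e1) (etrans leib (congr2 (fun x y : pol n => x + y) e2 e3)).
Qed.

(** The classical [x y, z] = x [y, z] + y [x, z]: skew-symmetry turns the left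
side into - [c_r (a o_s b)], to which the Leibniz rule applies. *)
Lemma brl_op_mixed n (s t : scal n) a b c :
  (forall (s t : scal n) a b c, nest (br a) s t (op b c) =
    mixed (- der - s - t) s c a b + mixed t s b a c) ->
  nest (br^~ c) (s + t) s (op a b) = mixed t s b a c + mixed s t a b c.
Proof.
move=> leib; have [r rE] : exists r : scal n, - der - s - t = r by eexists.
have e1 : mixed t r b c a = - mixed t s b a c.
  exact: mixed_skew_eq (thirdK (thirdC rE)).
have e2 : mixed s r a c b = - mixed s t a b c.
  exact: mixed_skew_eq (thirdK rE).
have e3 : nest (br c) r s (op a b) = mixed t r b c a + mixed s r a c b.
  apply: etrans (leib r s c a b) _.
  exact: (congr1 (fun u => mixed u r b c a + _) (thirdC (thirdK rE))).
have r_eq : - der - (s + t) = r by rewrite opp_der_subD.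
apply: etrans (nest_skewl br_lie (s + t) s c (op a b)) _.
apply: etrans (congr1 (fun u => - nest (br c) u s (op a b)) r_eq) _.
rewrite e3 e1 e2; move: (mixed t s b a c) (mixed s t a b c) => x y.
by rewrite opprD !opprK.
Qed.

(** Once both brackets of the transposed Leibniz identity are expanded, the two
copies of a o_s [b_t c] cancel those on the left. *)
Lemma mixed_symm_of_sum n (s t : scal n) a b c :
  mixed s t a b c *+ 2 =
    (mixed t s b a c + mixed s t a b c) +
    (mixed (- der - t - s) t c b a + mixed s t a b c) ->
  mixed t s b a c = mixed (- der - s - t) s c a b.
Proof.
have [r rE] : exists r : scal n, - der - s - t = r by eexists.
have e : mixed (- der - t - s) t c b a = - mixed r s c a b.
  rewrite (thirdC rE).
  exact: mixed_skew_eq (thirdC (thirdK (thirdC rE))).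
rewrite rE e.
move: (mixed s t a b c) (mixed t s b a c) (mixed r s c a b) => x y z.
rewrite addrACA -mulr2n -[LHS]add0r => /addIr yz0.
by apply/eqP; rewrite -subr_eq0; apply/eqP.
Qed.

Lemma mixed_symm_of_leibniz :
  (forall (s t : scal 2) a b c, nest (br a) s t (op b c) =
    mixed (- der - s - t) s c a b + mixed t s b a c) ->
  (forall a b c : A,
    cprod op lam2 (cst a) (cprod br mu (cst b) (cst c)) *+ 2 =
    cprod br (lam2 + mu) (cprod op lam2 (cst a) (cst b)) (cst c) +
    cprod br mu (cst b) (cprod op lam2 (cst a) (cst c))) ->
  forall (s t : scal 2) a b c,
    mixed t s b a c = mixed (- der - s - t) s c a b.
Proof.
move=> leib tleib s t a b c.
have formal : mixed mu lam2 b a c = mixed (- der - lam2 - mu) lam2 c a b.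
  have := tleib a b c.
  rewrite op_br_mixed brl_op_nest br_op_nest_swap (brl_op_mixed _ _ _ _ _ leib).
  by rewrite leib; exact: mixed_symm_of_sum.
move: formal => /(congr1 (extend (pair_var s t) cst)).
have e1 := sub_mixed b a c (slides_mu s t) (slides_lam2 s t).
have e2 := sub_mixed c a b (slides_third s t) (slides_lam2 s t).
by move=> formal; exact: etrans (esym e1) (etrans formal e2).
Qed.

(** The parameters lam2 + mu and lam2 are independent: lam2 := t and
mu := s - t turn them into any s and t. *)
Lemma brl_op_vanish n (s t : scal n) a b c :
  (forall a b c : A,
    cprod br (lam2 + mu) (cprod op lam2 (cst a) (cst b)) (cst c) = 0) ->
  nest (br^~ c) s t (op a b) = 0.
Proof.
move=> /(_ a b c); rewrite brl_op_nest.
move=> /(congr1 (extend (pair_var t (s - t)) cst)).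
have sE : t + (s - t) = s by rewrite addrC subrK.
have slide_s := slides_lam2Dmu t (s - t); rewrite sE in slide_s.
have e := sub_nest (conf_addl br_conf c) (op a b) slide_s
  (slides_lam2 t (s - t)).
move=> vanish; apply: etrans (esym e) _; apply: etrans vanish _.
exact: morphD0 (extendD _ (@cstD n)).
Qed.

(** Skew-symmetry moves the product o from the right argument of the bracket to
the left one; - d - s is the parameter that skew-symmetry sends to s. *)
Lemma br_op_vanish n (s t : scal n) a b c :
  (forall a b c : A,
    cprod br (lam2 + mu) (cprod op lam2 (cst a) (cst b)) (cst c) = 0) ->
  nest (br a) s t (op b c) = 0.
Proof.
move=> vanish; apply: oppr_inj; rewrite oppr0.
have sE : - der - (- der - s) = s by exact: subKr.
apply: etrans (brl_op_vanish (- der - s) t b c a vanish).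
apply: etrans _ (esym (nest_skewl br_lie (- der - s) t a (op b c))).
exact: (congr1 (fun u => - nest (br a) u t (op b c)) (esym sE)).
Qed.

Lemma mixed_vanish n (s t : scal n) a b c :
  (forall a b c : A,
    cprod op lam2 (cst a) (cprod br mu (cst b) (cst c)) = 0) ->
  mixed s t a b c = 0.
Proof.
move=> /(_ a b c); rewrite op_br_mixed.
move=> /(congr1 (extend (pair_var s t) cst)).
have e := sub_mixed a b c (slides_lam2 s t) (slides_mu s t).
move=> vanish; apply: etrans (esym e) _; apply: etrans vanish _.
exact: morphD0 (extendD _ (@cstD n)).
Qed.

Lemma poisson_and_transposed_vanish : (2%:R : C) != 0 ->
  poisson_conformal op br -> transposed_poisson_conformal op br ->
  forall a b c : A,
  [/\ cprod op lam2 (cst a) (cprod br mu (cst b) (cst c)) = 0,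
      cprod op mu (cprod br (mu - lam2) (cst b) (cst a)) (cst c) = 0
    & cprod br (lam2 + mu) (cprod op lam2 (cst a) (cst b)) (cst c) = 0].
Proof.
move=> two_neq0 pois tpois a b c.
have leib (s t : scal 2) a' b' c' :=
  leibniz_nest s t a' b' c' (pois_leibniz pois).
have symm := mixed_symm_of_leibniz leib (tpois_leibniz tpois).
have mixed0 := mixed_symm_eq0 two_neq0 symm.
split; [rewrite op_br_mixed | rewrite opl_br_mixed | rewrite brl_op_nest].
- exact: mixed0.
- exact: mixed0.
rewrite [LHS](brl_op_mixed _ _ _ _ _ leib).
apply: etrans (congr2 (fun x y : pol 2 => x + y) (mixed0 _ _ _ _ _)
  (mixed0 _ _ _ _ _)) _.
exact: addr0.
Qed.

Lemma vanish_poisson_and_transposed :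
  (forall a b c : A,
    cprod op lam2 (cst a) (cprod br mu (cst b) (cst c)) = 0) ->
  (forall a b c : A,
    cprod br (lam2 + mu) (cprod op lam2 (cst a) (cst b)) (cst c) = 0) ->
  poisson_conformal op br /\ transposed_poisson_conformal op br.
Proof.
move=> op_br0 brl_op0.
have mixed0 n (s t : scal n) a b c := mixed_vanish s t a b c op_br0.
have nest0 n (s t : scal n) a b c := br_op_vanish s t a b c brl_op0.
split; [apply: (PoissonConformal op_ca br_lie) => a b c
       | apply: (TransposedPoissonConformal op_ca br_lie) => a b c].
  rewrite br_op_nest opl_br_nest op_br_mixed_swap nestl_mixed.
  apply: etrans (nest0 _ _ _ _ _ _) (esym _).
  apply: etrans (congr2 (fun x y : pol 2 => x + y) (mixed0 _ _ _ _ _ _)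
    (mixed0 _ _ _ _ _ _)) _.
  exact: addr0.
rewrite op_br0 brl_op0 br_op_nest_swap mul0rn add0r.
exact: esym (nest0 _ _ _ _ _ _).
Qed.

End TwoProducts.

End Semilinear.

Theorem proposition3p8 (R : realType) (L : lmodType {poly R[i]})
    (op br : L -> L -> polymod L (expn_of 1))
    (op_ca : comm_assoc_conformal op) (br_lie : lie_conformal br) :
  (poisson_conformal op br /\ transposed_poisson_conformal op br) <->
  (forall a b c : L,
    [/\ cprod op lam2 (cst a) (cprod br mu (cst b) (cst c)) = 0,
        cprod op mu (cprod br (mu - lam2) (cst b) (cst a)) (cst c) = 0
      & cprod br (lam2 + mu) (cprod op lam2 (cst a) (cst b)) (cst c)
        = 0]).
Proof.
split=> [[pois tpois]|vanish].
  by apply: poisson_and_transposed_vanish => //; rewrite Num.Theory.pnatr_eq0.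
apply: vanish_poisson_and_transposed => //.
- by move=> a b c; case: (vanish a b c).
- by move=> a b c; case: (vanish a b c).
Qed.
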